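(* Let the per-gate cost be $c$, the success value be $U$, and the objective be $J(k)=U r_k-ck$, where $r_k=\frac{p_0}{p_0+(1-p_0)m_k}$ and $m_k=\mathbb{E}_{\alpha\sim G}[\alpha^k]$. Suppose $G$ has no atom at $1$ and has density $g(\alpha)\sim c_G(1-\alpha)^{b-1}$ as $\alpha\uparrow1$ for some $b,c_G>0$, so that $1-r_k\sim\kappa k^{-b}$ with $\kappa=\frac{1-p_0}{p_0}c_G\Gamma(b)$. Then the optimum scales as $$k^{*}\approx\Big(\frac{U\kappa b}{c}\Big)^{1/(b+1)}\quad\text{(power law)},$$ versus, when gates are independent ($G=\delta_{\bar\alpha}$, a point mass), $$k^{*}_{\mathrm{indep}}\sim\frac{\ln(U/c)}{\ln(1/\bar\alpha)}\quad\text{(logarithmic)}.$$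
   Context: $G$ is a probability distribution supported on $[0,1]$. A candidate answer is correct with prior probability $p_0$ and is passed through $k$ verification gates. Correct answers are always accepted; an erroneous answer carries a latent false-accept rate $\alpha\sim G$, given which the gate verdicts are i.i.d. Bernoulli$(\alpha)$. $r_k$ is the probability that the answer is correct given that all $k$ gates accept, and $k^*$ is the gate count optimizing $J$. $\bar\alpha=\mathbb{E}_{\alpha\sim G}[\alpha]$ is the mean false-accept rate. *)

(* Defs.v *)
From HB Require Import structures.
From mathcomp Require Import all_boot all_order all_algebra.
From mathcomp Require Import all_classical all_reals all_analysis.

Set Implicit Arguments.
Unset Strict Implicit.
Unset Printing Implicit Defensive.

Import Order.TTheory GRing.Theory Num.Theory.
Import numFieldNormedType.Exports.

Local Open Scope classical_set_scope.
Local Open Scope ring_scope.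

Definition Gamma (R : realType) (b : R) : R :=
  fine (\int[lebesgue_measure]_(t in `]0%R, +oo[)
          (t `^ (b - 1) * expR (- t))%:E)%E.

Section gates.
Variable R : realType.
Implicit Types (G : probability (measurableTypeR R) R) (p U c : R).

Definition supported01 G : Prop := G `[0, 1]%classic = 1%E.

Definition moment G (k : nat) : R := fine 'E_G[(fun a : R => (a ^+ k)%R)]%E.

Definition mean_rate G : R := fine 'E_G[(fun a : R => a)]%E.

Definition point_mass (a : R) : probability (measurableTypeR R) R :=
  @dirac _ (measurableTypeR R) a R.

(* Bayes: a correct answer (prior p) passes k gates with probability 1; given
   its rate a ~ G an erroneous one passes them with probability a ^+ k. *)
Definition posterior G p (k : nat) : R :=
  p / (p + (1 - p) * moment G k).

Definition objective G p U c (k : nat) : R :=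
  U * posterior G p k - c * k%:R.

(* The maximizer over the natural numbers need not be unique. *)
Definition optimal_gates G p U c (k : nat) : Prop :=
  forall j : nat, objective G p U c j <= objective G p U c k.

(* Density near 1 only: on some left neighbourhood ]a, 1[ of 1, G is
   absolutely continuous with density g; nothing is required of G on [0, a]. *)
Definition left_density_at1 G (g : R -> R) : Prop :=
  exists a : R, [/\ a < 1,
    measurable_fun (`]a, 1[ : set R) g,
    (forall x, a < x < 1 -> 0 <= g x) &
    forall A : set R, measurable A -> A `<=` `]a, 1[ ->
      G A = (\int[lebesgue_measure]_(x in A) (g x)%:E)%E].

Definition kappa p cG b : R := (1 - p) / p * cG * Gamma b.

End gates.

(* Main.v *)
(* Only the mass of G near 1 matters for large k: since g(x) ~ cG (1-x)^(b-1),
   the moment m_k is squeezed between multiples close to cG of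
   \int_(1-delta)^1 x^k (1-x)^(b-1) dx, up to (1-delta)^k.  Substituting
   x = 1 - t/k turns k^b times this integral into
   \int_0^(delta k) (1-t/k)^k t^(b-1) dt, which tends to Gamma(b) by dominated
   convergence because (1-t/k)^k increases to e^-t.  Hence 1 - r_k ~ kappa k^-b.
   Maximizing U r_k - c k amounts to minimizing lam e_k + k with lam = U/c and
   e_k = 1 - r_k, and the minimizer is located by comparing its cost with that of
   one explicit competitor, so no regularity of e_{k+1} - e_k is needed.
   The bound mean < 1 comes from 1 - k (1 - m_1) <= m_k -> 0. *)

Require Import Defs.
From HB Require Import structures.
From mathcomp Require Import all_boot all_order all_algebra.
From mathcomp Require Import all_classical all_reals all_analysis.
From mathcomp Require Import measurable_realfun ring lra.

Set Implicit Arguments.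
Unset Strict Implicit.
Unset Printing Implicit Defensive.

Import Order.TTheory GRing.Theory Num.Theory.
Import numFieldNormedType.Exports.

Local Open Scope classical_set_scope.
Local Open Scope ring_scope.

(** * Minimizers of lam e_k + k *)

Section minimizers.
Variable R : realType.
Implicit Types (e lam : nat -> R) (kstar : nat -> nat).

Lemma near_equiv (f g : nat -> R) :
  (forall eps, 0 < eps -> \forall n \near \oo, `|f n - g n| <= eps * `|g n|) ->
  f ~_\oo g.
Proof. by move=> fg; apply/eqaddoP. Qed.

(* Both x^-b - 1 + b ln x and x - 1 - ln x are nonnegative, which makes the gap at
   least x - 1 - ln x; then ln x = 2 ln (sqrt x) <= 2 (sqrt x - 1). *)
Lemma powR_gap (b x : R) : 0 < b -> 0 < x ->
  (Num.sqrt x - 1) ^+ 2 <= x `^ (- b) / b + x - (b^-1 + 1).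
Proof.
move=> b0 x0.
have s0 : 0 < Num.sqrt x by rewrite sqrtr_gt0.
have sx : Num.sqrt x ^+ 2 = x by rewrite sqr_sqrtr// ltW.
have lnx : ln x <= 2 * (Num.sqrt x - 1).
  rewrite -{1}sx lnXn// mulr2n.
  have : ln (1 + (Num.sqrt x - 1)) <= Num.sqrt x - 1 by apply: le_ln1Dx; lra.
  rewrite addrC subrK => h; lra.
have xb : b^-1 - ln x <= x `^ (- b) / b.
  rewrite ler_pdivlMr// mulrBl mulVf ?gt_eqF// /powR gt_eqF//.
  apply: le_trans (expR_ge1Dx _); lra.
rewrite sqrrB sx expr1n mulr1; lra.
Qed.

(** Factor [x - 1] as (sqrt x - 1)(2 + (sqrt x - 1)). This turns the square produced by [powR_gap]
    into closeness of [x] to 1. *)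
Lemma sqrt_near1 (x s : R) : 0 < x -> 0 <= s -> (Num.sqrt x - 1) ^+ 2 <= s ^+ 2 ->
  `|x - 1| <= s * (2 + s).
Proof.
move=> x0 s0 h2; have h : `|Num.sqrt x - 1| <= s.
  by rewrite -(@ler_pXn2r _ 2)// ?nnegrE// real_normK// num_real.
rewrite (_ : x - 1 = (Num.sqrt x - 1) * (2 + (Num.sqrt x - 1))); last first.
  by rewrite -{1}(sqr_sqrtr (ltW x0)); ring.
rewrite normrM ler_pM//.
by rewrite (le_trans (ler_normD _ _))// lerD// ger0_norm.
Qed.

(** A minimizer below [K] costs at least [lam n * e K]. A fixed [N] with [e N < e K / 2] costs less
    than [lam n * e K / 2 + N], which is cheaper once [lam n] is large. *)
Lemma cvg_minimizer e lam kstar :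
  (forall k, 0 < e k) -> {homo e : j k / (j <= k)%N >-> k <= j} ->
  e @ \oo --> 0 -> lam @ \oo --> +oo ->
  (forall n j, lam n * e (kstar n) + (kstar n)%:R <= lam n * e j + j%:R) ->
  forall K, \forall n \near \oo, (K <= kstar n)%N.
Proof.
move=> e0 emono ecvg lamy opt K.
have [N _ HN] : \forall k \near \oo, e k < e K / 2.
  have /cvgrPdist_lt/(_ (e K / 2)) := ecvg.
  rewrite divr_gt0// => /(_ isT); apply: filterS => k.
  by rewrite sub0r normrN gtr0_norm.
have {HN}eN : e N < e K / 2 by apply: HN => /=.
have /cvgryPge/(_ ((N%:R + 1) / (e K / 2))) := lamy.
apply: filterS => n; rewrite ler_pdivrMr ?divr_gt0// => hn.
rewrite leqNgt; apply/negP => /ltnW/emono eK.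
have := opt n N.
have lam0 : 0 < lam n.
  rewrite -(pmulr_lgt0 _ (_ : 0 < e K / 2)) ?divr_gt0//; apply: lt_le_trans hn.
  by rewrite ltr_wpDl.
have h1 : lam n * e K <= lam n * e (kstar n) by rewrite ler_pM2l.
have h2 : lam n * e N <= lam n * (e K / 2) by rewrite ler_pM2l// ltW.
have h3 : 0 <= (kstar n)%:R :> R by [].
move: hn h1 h2 h3; set x := (kstar n)%:R; set y := N%:R; move=> *; lra.
Qed.

Lemma natr_ceil (x : R) : 0 <= x -> exists j : nat, x <= j%:R <= x + 1.
Proof.
move=> x0; exists (Num.truncn x).+1; have /andP[h1 h2] := truncn_itv x0.
by rewrite ltW//= -natr1 lerD2r.
Qed.

Lemma cvgy_powR (u : nat -> R) (a : R) : 0 < a ->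
  u @ \oo --> +oo -> u n `^ a @[n --> \oo] --> +oo.
Proof.
move=> a0 uy; apply/cvgryPge => A.
have /cvgryPge/(_ (Num.max A 1 `^ a^-1)) := uy.
apply: filterS => n h.
have M0 : 0 < Num.max A 1 by rewrite lt_max ltr01 orbT.
apply: (@le_trans _ _ (Num.max A 1)); first by rewrite le_max lexx.
have -> : Num.max A 1 = (Num.max A 1 `^ a^-1) `^ a.
  by rewrite -powRrM mulVf ?gt_eqF// powRr1// ltW.
rewrite ge0_ler_powR// ?nnegrE ?powR_ge0// ?ltW//.
by apply: lt_le_trans h; rewrite powR_gt0.
Qed.

(* In the scale k = x T with T^(b+1) = lam kap b, the cost lam e_k + k is about
   T (x^-b / b + x), whose unique minimum is at x = 1. *)
Lemma power_law_minimizer e lam kstar (b kap : R) : 0 < b -> 0 < kap ->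
  (forall k, 0 < e k) -> {homo e : j k / (j <= k)%N >-> k <= j} ->
  (fun k => k%:R `^ b * e k) @ \oo --> kap ->
  (forall n, 0 < lam n) -> lam @ \oo --> +oo ->
  (forall n j, lam n * e (kstar n) + (kstar n)%:R <= lam n * e j + j%:R) ->
  (fun n => (kstar n)%:R) ~_\oo (fun n => (lam n * kap * b) `^ (b + 1)^-1).
Proof.
move=> b0 kap0 e0 emono ecvg lam0 lamy opt.
have ebnd h : 0 < h -> \forall k \near \oo,
    (1 - h) * kap * k%:R `^ (- b) <= e k <= (1 + h) * kap * k%:R `^ (- b).
  move=> h0.
  have /cvgrPdist_le/(_ (h * kap)) := ecvg; rewrite mulr_gt0// => /(_ isT) H.
  near=> k.
  have k0 : 0 < k%:R `^ b :> R.
    by rewrite powR_gt0// ltr0n; near: k; exact: nbhs_infty_gt.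
  have : `|kap - k%:R `^ b * e k| <= h * kap by near: k; exact: H.
  rewrite powRN ler_pdivlMr// ler_pdivrMr// ler_distlC => /andP[h1 h2].
  by apply/andP; split; [move: h1|move: h2]; rewrite mulrC; lra.
have ecvg0 : e @ \oo --> 0.
  apply/cvgrPdist_le => d d0.
  have k1 : (k%:R `^ b : R) @[k --> \oo] --> +oo.
    by apply: cvgy_powR => //; exact: cvgr_idn.
  have /cvgryPge/(_ ((1 + 1) * kap / d)) := k1.
  have := @ebnd 1 ltr01; apply: filter_app2; near=> k; move=> /andP[_ h] h1.
  rewrite sub0r normrN gtr0_norm//; apply: le_trans h _.
  have kb0 : 0 < k%:R `^ b :> R.
    by rewrite powR_gt0// ltr0n; near: k; exact: nbhs_infty_gt.
  by rewrite powRN ler_pdivrMr// (mulrC d) -ler_pdivrMr.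
have kbig := cvg_minimizer e0 emono ecvg0 lamy opt.
apply: near_equiv => eps eps0.
(* [sqrt_near1] will give |x - 1| <= s (2 + s), which is at most 3 s <= eps. *)
pose s := Num.min 1 (eps / 3).
have s0 : 0 < s by rewrite lt_min ltr01 divr_gt0.
have s1 : s <= 1 by rewrite ge_min lexx.
have s3 : s <= eps / 3 by rewrite ge_min lexx orbT.
(* [B] will bound x^-b: for h <= 1/2 and T >= 1, [key] yields x^-b <= 3 + 4 b. Then [h] is taken
   small enough that the error h (1 + B) / b stays below s^2 / 2. *)
pose B := 4 + 4 * b + 2 * b.
pose h := Num.min 2^-1 (s ^+ 2 / (2 * ((1 + B) / b))).
have B0 : 0 < (1 + B) / b by rewrite divr_gt0//; rewrite /B; lra.
have h0 : 0 < h.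
  by rewrite lt_min invr_gt0 ltr0n/= divr_gt0 ?exprn_gt0// mulr_gt0.
have h2 : h <= 2^-1 by rewrite ge_min lexx.
have hs : h * ((1 + B) / b) <= s ^+ 2 / 2.
  rewrite -ler_pdivlMr//.
  by rewrite -mulrA -invfM ge_min lexx orbT.
pose T n := (lam n * kap * b) `^ (b + 1)^-1.
have L0 n : 0 < lam n * kap * b by rewrite !mulr_gt0.
have T0 n : 0 < T n by rewrite powR_gt0.
have Ty : T @ \oo --> +oo.
  apply: cvgy_powR; first by rewrite invr_gt0 addr_gt0.
  apply/cvgryPge => A; have /cvgryPge/(_ (A / b / kap)) := lamy.
  by apply: filterS => n; rewrite !ler_pdivrMr.
have TE n : lam n * kap = T n * T n `^ b / b.
  rewrite -{1}(powRr1 (ltW (T0 n))) -powRD; last by rewrite (gt_eqF (T0 n)) implybT.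
  rewrite -powRrM addrC mulVf ?gt_eqF ?addr_gt0// powRr1 ?(ltW (L0 n))//.
  by rewrite mulfK// gt_eqF.
have [K _ HK] := ebnd _ h0.
near=> n.
have hk : (maxn K 1 <= kstar n)%N by near: n; exact: kbig.
(* The first bound puts the competitor in the range where the estimate of [e] holds; the other two
   give T^-1 <= 1 and T^-1 <= s^2 / 2. *)
have : Num.max K%:R (Num.max 1 (2 / s ^+ 2)) <= T n.
  by near: n; move/cvgryPge: Ty; exact.
rewrite !ge_max => /and3P[TK T1 Ts].
(* The competitor is [T n] rounded up. Rounding can only lower the bound on [e] and adds at most 1
   to the gate count, hence the term [(T n)^-1] in [key]. *)
have [j /andP[Tj jT]] := natr_ceil (ltW (T0 n)).
have Kk : (K <= kstar n)%N by apply: leq_trans hk; rewrite leq_maxl.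
have k0 : 0 < (kstar n)%:R :> R.
  by rewrite ltr0n; apply: leq_trans hk; rewrite leq_maxr.
have Kj : (K <= j)%N by rewrite -(ler_nat R) (le_trans TK).
have /andP[lo _] := HK _ Kk; have /andP[_ up] := HK _ Kj.
have j0 : 0 < j%:R :> R by exact: lt_le_trans Tj.
have up' : e j <= (1 + h) * kap * T n `^ (- b).
  apply: (le_trans up); rewrite ler_pM2l ?mulr_gt0 ?addr_gt0//.
  rewrite !powRN lef_pV2 ?posrE ?powR_gt0//.
  by rewrite ge0_ler_powR// ?nnegrE ltW.
set x := (kstar n)%:R / T n.
have x0 : 0 < x by rewrite divr_gt0.
have kE : (kstar n)%:R = x * T n by rewrite divfK// gt_eqF.
(* optimality of [kstar n] against [j], divided by [T n] *)
have key : (1 - h) * (x `^ (- b) / b) + x <= (1 + h) / b + 1 + (T n)^-1.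
  rewrite -(ler_pM2r (T0 n)).
  have := opt n j; rewrite kE => Hopt.
  have l1 : lam n * ((1 - h) * kap * (kstar n)%:R `^ (- b)) <= lam n * e (kstar n).
    by rewrite ler_pM2l.
  have l2 : lam n * e j <= lam n * ((1 + h) * kap * T n `^ (- b)) by rewrite ler_pM2l.
  have TT : T n `^ b * T n `^ (- b) = 1 by rewrite powRN mulfV// gt_eqF// powR_gt0.
  have l3 : lam n * ((1 - h) * kap * (kstar n)%:R `^ (- b)) =
      (1 - h) * (x `^ (- b) / b) * T n.
    rewrite kE powRM ?(ltW x0) ?(ltW (T0 n))//.
    transitivity ((1 - h) * (lam n * kap) * (x `^ (- b) * T n `^ (- b))); first ring.
    rewrite TE.
    transitivity ((1 - h) * (x `^ (- b) / b) * T n * (T n `^ b * T n `^ (- b))); first ring.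
    by rewrite TT mulr1.
  have l4 : lam n * ((1 + h) * kap * T n `^ (- b)) = (1 + h) / b * T n.
    transitivity ((1 + h) * (lam n * kap) * T n `^ (- b)); first ring.
    rewrite TE.
    transitivity ((1 + h) / b * T n * (T n `^ b * T n `^ (- b))); first ring.
    by rewrite TT mulr1.
  have l5 : (T n)^-1 * T n = 1 by rewrite mulVf// gt_eqF.
  rewrite mulrDl [leRHS]mulrDl l5 -l3 (mulrDl _ 1) -l4 mul1r; lra.
have Tinv1 : (T n)^-1 <= 1 by rewrite invf_le1.
have Tinvs : (T n)^-1 <= s ^+ 2 / 2.
  by rewrite -[leRHS]invrK lef_pV2 ?posrE ?invr_gt0 ?divr_gt0 ?exprn_gt0// invf_div.
have xb0 : 0 <= x `^ (- b) / b by rewrite divr_ge0 ?powR_ge0// ltW.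
have xB : x `^ (- b) <= B.
  have h1 : 2^-1 * (x `^ (- b) / b) <= (1 - h) * (x `^ (- b) / b).
    by apply: ler_wpM2r => //; lra.
  have hb : (1 + h) / b <= (3 / 2) / b by rewrite ler_pM2r ?invr_gt0//; lra.
  have h3 : x `^ (- b) / b <= 3 / b + 4 by lra.
  move: h3; rewrite ler_pdivrMr// mulrDl divfK ?gt_eqF//.
  by move=> h3; apply: (le_trans h3); rewrite /B; lra.
have hxB : h * (x `^ (- b) / b) <= h * (B / b).
  by rewrite ler_pM2l// ler_pM2r ?invr_gt0.
have gap := powR_gap b0 x0.
(* By [key] the gap is at most h / b + h x^-b / b + T^-1 <= h (1 + B) / b + s^2 / 2. *)
have : (Num.sqrt x - 1) ^+ 2 <= s ^+ 2.
  apply: (le_trans gap).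
  move: hs; rewrite mulrDl mul1r mulrDr => hs.
  move: key; rewrite (mulrDl 1 h) mul1r => key.
  lra.
move/(sqrt_near1 x0 (ltW s0)) => xs.
have -> : (kstar n)%:R - T n = (x - 1) * T n by rewrite mulrBl mul1r -kE.
rewrite normrM ler_pM2r ?normr_gt0 ?gt_eqF//.
apply: (le_trans xs); apply: (@le_trans _ _ (s * 3)).
  by rewrite ler_pM2l//; lra.
lra.
Unshelve. all: by end_near. Qed.

(** Apply ln y <= y to y = a x. The slope may be as small as desired, at the price of the
    constant. *)
Lemma ln_le_linear (a : R) : 0 < a -> exists K : R, forall x, 0 < x -> ln x <= a * x + K.
Proof.
move=> a0; exists (- ln a) => x x0.
have := @ln_sublinear _ (a * x); rewrite mulr_gt0// lnM ?posrE// => /(_ isT).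
lra.
Qed.

(** Let L = ln lam / ln (1/a), so that lam a^L = 1. Rounding L up gives a competitor of cost at most
    C2 + 1 + L, which bounds [kstar] from above. The same bound on lam e_kstar gives C1 a^(kstar -
    L) <= C2 + 1 + L, so L - kstar is at most of order ln L. *)
Lemma geometric_law_minimizer e lam kstar (a C1 C2 : R) : 0 < a < 1 -> 0 < C1 ->
  (forall k, C1 * a ^+ k <= e k <= C2 * a ^+ k) ->
  (forall n, 0 < lam n) -> lam @ \oo --> +oo ->
  (forall n j, lam n * e (kstar n) + (kstar n)%:R <= lam n * e j + j%:R) ->
  (fun n => (kstar n)%:R) ~_\oo (fun n => ln (lam n) / ln a^-1).
Proof.
move=> /andP[a0 a1] C10 ebnd lam0 lamy opt.
set q := ln a^-1.
have q0 : 0 < q by rewrite ln_gt0// invf_gt1.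
have aE k : a ^+ k = expR (- (q * k%:R)).
  by rewrite /q lnV ?posrE// mulNr opprK mulrC expRM_natl lnK ?posrE.
have C20 : 0 < C2.
  have /andP[h1 h2] := ebnd 0%N; rewrite expr0 !mulr1 in h1 h2.
  by apply: (lt_le_trans C10); exact: le_trans h2.
apply: near_equiv => eps eps0.
have [|K HK] := @ln_le_linear (eps * q / 2); first by rewrite divr_gt0// mulr_gt0.
(* The logarithm is bounded with slope [eps * q / 2], so that L - kstar <= (eps / 2) L + M, with all
   constants gathered in [M]. *)
pose M := eps / 2 * (C2 + 1) + K / q - ln C1 / q.
have lny : ln (lam n) @[n --> \oo] --> +oo.
  apply/cvgryPge => A; have /cvgryPge/(_ (expR A)) := lamy.
  by apply: filterS => n hn; rewrite -(expRK A) ler_ln ?posrE ?expR_gt0.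
(* These thresholds make L positive, C2 + 1 <= eps L for the upper side, and M <= (eps / 2) L for
   the lower side. *)
have /cvgryPge/(_ (q * Num.max 1 (Num.max ((C2 + 1) / eps) (2 / eps * M)))) := lny.
apply: filterS => n.
rewrite mulrC -ler_pdivlMr//; set L := ln (lam n) / q.
rewrite !ge_max => /and3P[L1 L2 L3].
have lE : lam n = expR (q * L) by rewrite mulrC divfK ?gt_eqF// lnK ?posrE.
have L0 : 0 < L by exact: lt_le_trans L1.
have [j /andP[Lj jL]] := natr_ceil (ltW L0).
have lj : lam n * e j <= C2.
  have /andP[_ h2] := ebnd j.
  rewrite -ler_pdivlMl//; apply: (le_trans h2); rewrite mulrC ler_pM2r// lE -expRN aE.
  by rewrite ler_expR lerN2 ler_pM2l.
have up : lam n * e (kstar n) + (kstar n)%:R <= C2 + 1 + L.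
  by have := opt n j; lra.
have ek0 : 0 < lam n * e (kstar n).
  rewrite mulr_gt0//; have /andP[h1 _] := ebnd (kstar n).
  by apply: lt_le_trans h1; rewrite mulr_gt0// exprn_gt0.
have lo : C1 * expR (q * L - q * (kstar n)%:R) <= C2 + 1 + L.
  have /andP[h1 _] := ebnd (kstar n).
  have : lam n * (C1 * a ^+ kstar n) <= lam n * e (kstar n) by rewrite ler_pM2l.
  rewrite expRD -lE -aE => h2.
  have h3 : 0 <= (kstar n)%:R :> R by [].
  by rewrite mulrCA; move: h2 h3 up; lra.
have CL0 : 0 < C2 + 1 + L by rewrite !addr_gt0.
have : ln C1 + (q * L - q * (kstar n)%:R) <= ln (C2 + 1 + L).
  by rewrite -(expRK (q * L - _)) -lnM ?posrE ?expR_gt0// ler_ln ?posrE// mulr_gt0// expR_gt0.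
move/le_trans => /(_ _ (HK _ CL0)) lo2.
rewrite (gtr0_norm L0) ler_norml; apply/andP; split; last first.
  by move: L2; rewrite ler_pdivrMr// => L2; move: ek0 up L2; lra.
have {lo2} : L - (kstar n)%:R <= eps / 2 * L + M.
  rewrite -(ler_pM2l q0) mulrBr.
  have -> : q * (eps / 2 * L + M) = eps * q / 2 * (C2 + 1 + L) + K - ln C1.
    by rewrite /M; field; rewrite gt_eqF.
  lra.
have : M <= eps / 2 * L.
  move: L3; rewrite -(ler_pM2l (_ : 0 < eps / 2)) ?divr_gt0//.
  by rewrite mulrA (_ : eps / 2 * (2 / eps) = 1) ?mul1r//; field; rewrite gt_eqF.
lra.
Qed.

End minimizers.

(** * Densities and affine substitution *)

Section integration.
Local Open Scope ereal_scope.

(** Restricted to [D], [nu] is finite and dominated by [mu]. Its Radon-Nikodym derivative has the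
    same integral as [g] over every measurable subset of [D], hence equals [g] almost everywhere
    there, and change of measure applies. *)
Lemma ge0_integral_density d (T : measurableType d) (R : realType)
    (nu : {measure set T -> \bar R}) (mu : {sigma_finite_measure set T -> \bar R})
    (D : set T) (g : T -> R) (h : T -> \bar R) :
  measurable D -> nu D < +oo -> measurable_fun D g ->
  (forall A, measurable A -> A `<=` D -> nu A = \int[mu]_(x in A) (g x)%:E) ->
  measurable_fun D h -> (forall x, 0 <= h x) ->
  \int[nu]_(x in D) h x = \int[mu]_(x in D) (h x * (g x)%:E).
Proof.
move=> mD nuD mg nuE mh h0.
(* [nu] need not be dominated by [mu] outside [D] *)
pose nu' : {finite_measure set T -> \bar R} := mfrestr mD nuD.
have nu'E A : measurable A -> A `<=` D -> nu' A = nu A.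
  by move=> mA AD; rewrite /nu'/= /mfrestr /mrestr setIidl.
have mgE A : A `<=` D -> measurable_fun A (EFin \o g).
  by move=> AD; apply/measurable_EFinP; exact: measurable_funS mg.
have numu : nu' `<< mu.
  move=> A nA B mB BA; rewrite /nu'/= /mfrestr /mrestr.
  have mBD : measurable (B `&` D) by exact: measurableI.
  rewrite nuE//; apply: null_set_integral => //; first exact: mgE.
  by apply: nA => // x [/BA].
pose f := Radon_Nikodym_SigmaFinite.f nu' mu.
have fint : mu.-integrable setT f by exact: Radon_Nikodym_SigmaFinite.f_integrable.
have fg : ae_eq mu D f (EFin \o g).
  apply: integral_ae_eq => //.
  - exact: (integrableS measurableT).
  - exact: mgE.
  - move=> A AD mA; rewrite -[RHS]nuE// -nu'E//.
    by rewrite (Radon_Nikodym_SigmaFinite.f_integral numu).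
transitivity (\int[nu']_(x in D) h x).
  by apply: eq_measure_integral => A mA AD; exact/esym/nu'E.
rewrite -(Radon_Nikodym_SigmaFinite.change_of_variables numu)//.
apply: ae_eq_integral => //.
- apply: emeasurable_funM => //; apply: measurable_funTS.
  exact: measurable_int fint.
- by apply: emeasurable_funM => //; exact: mgE.
- exact: ae_eqe_mul2l.
Qed.

Lemma measurable_affine (R : realType) (c : R) :
  measurable_fun [set: measurableTypeR R] (fun t => (1 - c * t)%R : measurableTypeR R).
Proof. by apply: measurable_funB => //; exact: measurable_funM. Qed.

(** By uniqueness of Lebesgue measure only half-open intervals need checking: the preimage of ]a, b]
    has endpoints (1 - b) / c and (1 - a) / c, and scaling by [c] restores its length. *)
Lemma lebesgue_measure_affine (R : realType) (c : R) (c0 : (0 < c)%R)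
    (A : set (measurableTypeR R)) : measurable A ->
  pushforward (mscale (NngNum (ltW c0)) lebesgue_measure)
    (fun t : measurableTypeR R => (1 - c * t)%R : measurableTypeR R) A =
  lebesgue_measure A.
Proof.
move=> mA; apply/esym/lebesgue_measure_unique => //=.
  exact: measurable_affine.
move=> _ _ [[a b]] _ <-; rewrite /pushforward /mscale/=.
have -> : (fun t : measurableTypeR R => (1 - c * t)%R : measurableTypeR R) @^-1` `]a, b] =
    `[((1 - b) / c)%R, ((1 - a) / c)%R[%classic.
  apply/seteqP; split => t /=; rewrite !in_itv/= ler_pdivrMr// ltr_pdivlMr// => /andP[h1 h2].
    by apply/andP; split; lra.
  by apply/andP; split; lra.
rewrite !lebesgue_measure_itv/= !lte_fin ltr_pM2r ?invr_gt0// ltrD2l ltrN2.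
case: ifPn => _; last by rewrite mule0.
by rewrite -!EFinB -EFinM; congr EFin; field; rewrite gt_eqF.
Qed.

(** The substitution x = 1 - c t; with c = 1/k it magnifies the neighbourhood of 1 where the moments
    concentrate. *)
Lemma ge0_integral_affine (R : realType) (c : R) (D : set R) (f : R -> \bar R) :
  (0 < c)%R -> measurable D -> measurable_fun D f -> (forall x, D x -> 0 <= f x) ->
  \int[lebesgue_measure]_(x in D) f x = c%:E *
    \int[lebesgue_measure]_(t in [set t | D (1 - c * t)%R]) f (1 - c * t)%R.
Proof.
move=> c0 mD mf f0.
have mphi := @measurable_affine R c.
pose phi := fun t : measurableTypeR R => (1 - c * t)%R : measurableTypeR R.
have mphiD : measurable (phi @^-1` D) by rewrite -[X in measurable X]setTI; exact: mphi.
rewrite -[RHS](@ge0_integral_mscale _ _ R _ _ mphiD (NngNum (ltW c0)))//.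
- rewrite -(@ge0_integral_pushforward _ _ (measurableTypeR R) (measurableTypeR R) R
    phi mphi (mscale (NngNum (ltW c0)) lebesgue_measure) D f)//.
    by apply: eq_measure_integral => A mA _; exact/esym/lebesgue_measure_affine.
  by move=> y /set_mem; exact: f0.
- by apply: (measurable_comp mD) => //; [move=> _ [t Dt <-]|exact: measurable_funS mphi].
- by move=> t; exact: f0.
Qed.

End integration.

(** * The Gamma integral *)

Section gamma.
Variable R : realType.
Implicit Types (b s t x : R) (k : nat).
Local Notation mu := (@lebesgue_measure R).

(** Multiply ln t <= s t / (c + 1) + K by [c] and exponentiate; dividing by c + 1 rather than [c]
    covers c = 0. *)
Lemma powR_le_expR (c s : R) : 0 <= c -> 0 < s ->
  exists2 K : R, 0 < K & forall t, 0 < t -> t `^ c <= K * expR (s * t).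
Proof.
move=> c0 s0.
have c1 : 0 < c + 1 by rewrite ltr_wpDl.
have [|K HK] := @ln_le_linear R (s / (c + 1)); first by rewrite divr_gt0.
exists (expR (c * K)); first exact: expR_gt0.
move=> t t0; rewrite -expRD /powR gt_eqF// ler_expR.
apply: le_trans (_ : c * (s / (c + 1) * t + K) <= _).
  by rewrite ler_wpM2l// HK.
rewrite mulrDr addrC lerD2l mulrA ler_pM2r// mulrCA -[leRHS]mulr1 ler_pM2l//.
by rewrite ler_pdivrMr// mul1r lerDl.
Qed.

Lemma bernoulli_onem x k : 0 <= x <= 1 -> 1 - k%:R * x <= (1 - x) ^+ k.
Proof.
move=> /andP[x0 x1]; elim: k => [|k IH]; first by rewrite expr0 mul0r subr0.
rewrite exprS; apply: (@le_trans _ _ ((1 - x) * (1 - k%:R * x))).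
  rewrite -natr1 -subr_ge0.
  have : 0 <= k%:R * x ^+ 2 by rewrite mulr_ge0// sqr_ge0.
  by move=> h; apply: (le_trans h); rewrite le_eqVlt; apply/orP; left; apply/eqP; ring.
by apply: ler_wpM2l => //; lra.
Qed.

Lemma onem_expr_le_expR t k : t <= k.+1%:R ->
  (1 - k.+1%:R^-1 * t) ^+ k.+1 <= expR (- t).
Proof.
move=> tk; have -> : - t = k.+1%:R * (- (k.+1%:R^-1 * t)).
  by rewrite mulrN mulrA mulfV// mul1r.
rewrite expRM_natl lerXn2r// ?nnegrE ?expR_ge0//.
  by rewrite subr_ge0 mulrC ler_pdivrMr// mul1r.
exact: expR_ge1Dx.
Qed.

(** With x = t / (k + 1), e^x >= 1 + x gives 1 - x >= e^-x (1 - x^2). Raise this to the power k + 1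
    and apply Bernoulli to the last factor. *)
Lemma onem_expr_ge_expR t k : 0 <= t <= k.+1%:R ->
  expR (- t) * (1 - t ^+ 2 / k.+1%:R) <= (1 - k.+1%:R^-1 * t) ^+ k.+1.
Proof.
move=> /andP[t0 tk]; set x := k.+1%:R^-1 * t.
have x0 : 0 <= x by rewrite mulr_ge0.
have x1 : x <= 1 by rewrite /x mulrC ler_pdivrMr// mul1r.
have -> : - t = k.+1%:R * (- x) by rewrite /x mulrN mulrA mulfV// mul1r.
have -> : t ^+ 2 / k.+1%:R = k.+1%:R * x ^+ 2.
  by rewrite /x; field; rewrite -?natr1 ?gt_eqF// ltr_wpDl.
have xx : 0 <= x ^+ 2 <= 1 by rewrite sqr_ge0 expr_le1.
apply: (@le_trans _ _ (expR (- x) ^+ k.+1 * (1 - x ^+ 2) ^+ k.+1)).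
  by rewrite expRM_natl ler_wpM2l ?exprn_ge0 ?expR_ge0// bernoulli_onem.
rewrite -exprMn lerXn2r// ?nnegrE.
- by rewrite mulr_ge0 ?expR_ge0// subr_ge0; case/andP: xx.
- by rewrite subr_ge0.
have -> : 1 - x = expR (- x) * (expR x * (1 - x)).
  by rewrite mulrA -expRD addNr expR0 mul1r.
rewrite ler_wpM2l ?expR_ge0//.
rewrite (_ : 1 - x ^+ 2 = (1 + x) * (1 - x)); last by ring.
by rewrite ler_wpM2r ?subr_ge0// expR_ge1Dx.
Qed.

Lemma cvg_onem_expr t : 0 <= t ->
  (1 - k.+1%:R^-1 * t) ^+ k.+1 @[k --> \oo] --> expR (- t).
Proof.
move=> t0.
apply: (@squeeze_cvgr _ _ _ _ (fun k => expR (- t) * (1 - t ^+ 2 / k.+1%:R))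
    (fun=> expR (- t))).
- near=> k.
  have tk : t <= k.+1%:R.
    near: k; have [N _ HN] := nbhs_infty_ger t.
    by exists N => // k /= Nk; apply: HN; exact: leqW.
  by rewrite onem_expr_le_expR// onem_expr_ge_expR// t0.
- rewrite -[X in _ --> X]mulr1; apply: cvgMr => //.
  rewrite -[X in _ --> X]subr0; apply: cvgB; first exact: cvg_cst.
  rewrite -(mulr0 (t ^+ 2)); apply: cvgMr; exact: cvg_harmonic.
- exact: cvg_cst.
Unshelve. all: by end_near. Qed.

Lemma measurable_gamma_density b (D : set R) :
  measurable_fun D (fun t : R => t `^ (b - 1) * expR (- t)).
Proof.
apply: measurable_funTS; apply: measurable_funM; first exact: measurable_powR.
by apply: measurableT_comp => //; exact: measurable_expR.
Qed.

(** For b < 1 the integrand is unbounded at 0, so ]0, 1] is exhausted by compact intervals. On each,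
    the antiderivative t^b / b bounds the integral by 1/b, and monotone convergence concludes. *)
Lemma integral_powR_itv01_lty b : 0 < b ->
  (\int[mu]_(t in `]0%R, 1%R]) (t `^ (b - 1))%:E < +oo)%E.
Proof.
move=> b0.
have mp (D : set R) : measurable_fun D (fun t : R => (t `^ (b - 1))%:E).
  by apply/measurable_EFinP/measurable_funTS; exact: measurable_powR.
(* Starting at 1/2 keeps every interval nondegenerate, as the fundamental theorem of calculus
   requires. *)
pose F n := `[n.+2%:R^-1 : R, 1]%classic.
have FE : `]0%R, 1%R]%classic = \bigcup_n F n.
  apply/seteqP; split => t /=.
    rewrite in_itv/= => /andP[t0 t1].
    have [N _ HN] := nbhs_infty_ger t^-1.
    exists N => //=; rewrite /F/= in_itv/= t1 andbT -[leRHS]invrK lef_pV2 ?posrE ?invr_gt0//.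
    by apply: (le_trans (HN N (leqnn _))); rewrite ler_nat -addn2 leq_addr.
  move=> [n _]; rewrite /F/= !in_itv/= => /andP[nt ->]; rewrite andbT.
  by apply: lt_le_trans nt; rewrite invr_gt0.
have F0 n : 0 < n.+2%:R^-1 :> R by rewrite invr_gt0.
have ndF : nondecreasing_seq F.
  apply/nondecreasing_seqP => n; rewrite subsetEset => t; rewrite /F/= !in_itv/=.
  by move=> /andP[+ ->]; rewrite andbT; apply: le_trans; rewrite lef_pV2 ?posrE// ler_nat.
have p0 n (x : R) : F n x -> (0 <= (x `^ (b - 1))%:E)%E by rewrite lee_fin powR_ge0.
have Fcvg : (\int[mu]_(x in F n) (x `^ (b - 1))%:E @[n --> \oo] -->
    \int[mu]_(x in \bigcup_n F n) (x `^ (b - 1))%:E)%E.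
  apply: ge0_nondecreasing_set_cvg_integral => //.
  - by move=> n; exact: measurable_itv.
  - by move=> n; exact: mp.
rewrite FE; apply: (@le_lt_trans _ _ (b^-1)%:E); last exact: ltry.
rewrite -(cvg_lim _ Fcvg)//; apply: lime_le; first by apply/cvg_ex; eexists; exact: Fcvg.
apply: nearW => n.
have dF x : 0 < x -> is_derive x (1 : R) (fun t : R => b^-1 * t `^ b) (x `^ (b - 1)).
  move=> x0; have dp := is_derive1_powR b x0.
  have -> : x `^ (b - 1) = b^-1 *: (b * x `^ (b - 1)).
    by rewrite /GRing.scale/= mulrA mulVf ?mul1r// gt_eqF.
  exact: (is_deriveZ b^-1 dp).
have cF (c x : R) : 0 < x -> {for x, continuous (fun t : R => t `^ c)}.
  move=> x0; apply/differentiable_continuous/derivable1_diffP.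
  by apply: derivable_powR; rewrite in_itv/= x0.
have cF' (x : R) : 0 < x -> {for x, continuous (fun t : R => b^-1 * t `^ b)}.
  by move=> x0; apply: continuousM; [exact: cst_continuous|exact: cF].
rewrite (@continuous_FTC2 _ _ (fun t => b^-1 * t `^ b)).
- by rewrite powR1 mulr1 -EFinB lee_fin gerBl mulr_ge0 ?powR_ge0// invr_ge0 ltW.
- by rewrite invf_lt1// ltr1n.
- apply: continuous_in_subspaceT => x; rewrite inE/= in_itv/= => /andP[nx _].
  by apply: cF; exact: lt_le_trans nx.
- split.
  + move=> x; rewrite in_itv/= => /andP[nx _].
    by have [] := dF x (lt_trans (F0 n) nx).
  + by apply: cvg_at_right_filter; exact: cF'.
  + by apply: cvg_at_left_filter; exact: cF'.
- move=> x; rewrite in_itv/= => /andP[nx _].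
  by have [_ dE] := dF x (lt_trans (F0 n) nx); rewrite derive1E.
Qed.

(** Split at 1. On ]0, 1] drop e^-t. Beyond 1, t^(b-1) <= t^b <= K e^(t/2), so the integrand is at
    most 2 K times the exponential density of rate 1/2. *)
Lemma integrable_gamma_density b : 0 < b ->
  mu.-integrable `]0%R, +oo[ (fun t => (t `^ (b - 1) * expR (- t))%:E).
Proof.
move=> b0; apply/integrableP; split.
  by apply/measurable_EFinP; exact: measurable_gamma_density.
have p0 (t : R) : 0 <= t `^ (b - 1) * expR (- t) by rewrite mulr_ge0 ?powR_ge0 ?expR_ge0.
have mg (D : set R) : measurable_fun D (fun t : R => (t `^ (b - 1) * expR (- t))%:E).
  by apply/measurable_EFinP; exact: measurable_gamma_density.
under eq_integral do rewrite gee0_abs ?lee_fin//.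
rewrite (@itv_bndbnd_setU _ _ _ (BRight 1)) ?bnd_simp// ge0_integral_setU//; last 3 first.
- exact: mg.
- by move=> x _; rewrite lee_fin.
- apply/disj_setPS => x [] /=; rewrite !in_itv/= andbT => /andP[_ x1].
  by rewrite ltNge x1.
apply: lte_add_pinfty.
  apply: le_lt_trans (integral_powR_itv01_lty b0).
  apply: ge0_le_integral => //.
  - by move=> x _; rewrite lee_fin.
  - exact: mg.
  - by apply/measurable_EFinP/measurable_funTS; exact: measurable_powR.
  move=> x /=; rewrite in_itv/= => /andP[x0 _]; rewrite lee_fin.
  by rewrite -[leRHS]mulr1 ler_wpM2l ?powR_ge0// expR_le1 oppr_le0 ltW.
have h0 : 0 < 2^-1 :> R by rewrite invr_gt0.
have [K K0 HK] := powR_le_expR (ltW b0) h0.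

have mpdf (D : set R) : measurable_fun D (fun t : R => (exponential_pdf 2^-1 t)%:E).
  by apply/measurable_EFinP/measurable_funTS; exact: measurable_exponential_pdf.
have pdf0 x : (0 <= (exponential_pdf (2^-1 : R) x)%:E)%E.
  by rewrite lee_fin exponential_pdf_ge0// ltW.
apply: (@le_lt_trans _ _
  (\int[mu]_(x in `]1%R, +oo[) ((K * 2)%:E * (exponential_pdf 2^-1 x)%:E))%E).
  apply: ge0_le_integral => //.
  - by move=> x _; rewrite lee_fin.
  - exact: mg.
  - by apply: measurable_funeM; exact: mpdf.
  move=> x /=; rewrite in_itv/= andbT => x1.
  have x0 : 0 < x by exact: lt_trans x1.
  rewrite -EFinM lee_fin exponential_pdfE ?(ltW x0)//.
  have -> : K * 2 * (2^-1 * expR (- 2^-1 * x)) = K * expR (2^-1 * x) * expR (- x).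
    rewrite -mulrA (mulrA 2) mulfV// mul1r -mulrA -expRD; congr (_ * expR _); lra.
  rewrite ler_wpM2r ?expR_ge0//; apply: le_trans (HK _ x0).
  by rewrite ler_powR ?(ltW x1)//; lra.
rewrite ge0_integralZl_EFin// ?mulr_ge0 ?(ltW K0)//; last exact: mpdf.
apply: lte_mul_pinfty => //; first by rewrite lee_fin mulr_ge0// ltW.
apply: le_lt_trans (_ : (\int[mu]_x (exponential_pdf 2^-1 x)%:E < +oo)%E).
  by apply: ge0_subset_integral => //; exact: mpdf.
by rewrite integral_exponential_pdf// ltry.
Qed.

Lemma Gamma_EFin b : 0 < b ->
  (\int[mu]_(t in `]0%R, +oo[) (t `^ (b - 1) * expR (- t))%:E)%E = (Gamma b)%:E.
Proof. by move=> b0; rewrite fineK// integrable_fin_num//; exact: integrable_gamma_density. Qed.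

(** On [1, 2] the integrand is at least e^-2 / 2, because t^(b-1) >= 1/t >= 1/2 there. *)
Lemma Gamma_gt0 b : 0 < b -> 0 < Gamma b.
Proof.
move=> b0; rewrite -lte_fin -Gamma_EFin//.
have p0 (t : R) : 0 <= t `^ (b - 1) * expR (- t) by rewrite mulr_ge0 ?powR_ge0 ?expR_ge0.
have mg (D : set R) : measurable_fun D (fun t : R => (t `^ (b - 1) * expR (- t))%:E).
  by apply/measurable_EFinP; exact: measurable_gamma_density.
have c0 : 0 < 2^-1 * expR (- 2) :> R by rewrite mulr_gt0 ?expR_gt0.
apply: (@lt_le_trans _ _ (\int[mu]_(t in `[1%R, 2%R]) (2^-1 * expR (- 2))%:E)%E).
  rewrite integral_cst//= lebesgue_measure_itv/= lte_fin ltr1n -EFinB -EFinM lte_fin.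
  by rewrite mulr_gt0// subr_gt0 ltr1n.
apply: (@le_trans _ _ (\int[mu]_(t in `[1%R, 2%R]) (t `^ (b - 1) * expR (- t))%:E)%E).
  apply: ge0_le_integral => //.
    exact: mg.
  move=> x /=; rewrite in_itv/= => /andP[x1 x2]; rewrite lee_fin.
  rewrite ler_pM ?expR_ge0// ?ler_expR ?lerN2//.
  apply: (@le_trans _ _ (x `^ (-1))); last by rewrite ler_powR//; lra.
  by rewrite powR_inv1 ?lef_pV2 ?posrE//; lra.
apply: ge0_subset_integral => //.
- exact: mg.
- by move=> x _; rewrite lee_fin.
- by move=> x /=; rewrite !in_itv/= andbT => /andP[x1 _]; exact: lt_le_trans x1.
Qed.

End gamma.

(** * Scaled beta integrals *)

Section beta.
Variable R : realType.
Implicit Types (b delta t x : R) (k : nat).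
Local Notation mu := (@lebesgue_measure R).

Lemma measurable_beta_density b k (D : set R) :
  measurable_fun D (fun x : R => (x ^+ k * (1 - x) `^ (b - 1))%:E).
Proof.
apply/measurable_EFinP/measurable_funTS/measurable_funM.
  exact: measurable_funX.
by apply: (measurableT_comp (measurable_powR _)); exact: measurable_funB.
Qed.

(** Substitute x = 1 - t/n with n = k + 1: the Jacobian 1/n and the factor n^(1-b) from (t/n)^(b-1)
    combine to n^-b. *)
Lemma scaled_beta_integral b delta k : 0 < b -> 0 < delta <= 1 ->
  ((k.+1%:R `^ b)%:E *
    \int[mu]_(x in `](1 - delta)%R, 1%R[) (x ^+ k.+1 * (1 - x) `^ (b - 1))%:E =
  \int[mu]_(t in `]0%R, (delta * k.+1%:R)%R[)
    ((1 - k.+1%:R^-1 * t) ^+ k.+1 * t `^ (b - 1))%:E)%E.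
Proof.
move=> b0 /andP[d0 d1].
set n := k.+1%:R : R; have n0 : 0 < n by [].
have ni0 : 0 < n^-1 by rewrite invr_gt0.
have D0 x : `](1 - delta)%R, 1%R[%classic x -> 0 <= x ^+ k.+1 * (1 - x) `^ (b - 1).
  rewrite /= in_itv/= => /andP[x1 _].
  by rewrite mulr_ge0 ?powR_ge0// exprn_ge0//; lra.
rewrite (@ge0_integral_affine _ n^-1)//; last exact: measurable_beta_density.
have -> : [set t | `](1 - delta)%R, 1%R[%classic (1 - n^-1 * t)] =
    `]0%R, (delta * n)%R[%classic.
  apply/seteqP; split => t /=; rewrite !in_itv/= ltrD2l ltrN2 gtrBl pmulr_rgt0//;
    by rewrite (mulrC n^-1) ltr_pdivrMr// andbC.
rewrite muleA -EFinM -ge0_integralZl_EFin//.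
- apply: eq_integral => t; rewrite inE/= in_itv/= => /andP[t0 _].
  rewrite -EFinM; congr EFin.
  rewrite (_ : 1 - (1 - n^-1 * t) = n^-1 * t); last by ring.
  rewrite powRM ?(ltW ni0) ?(ltW t0)//.
  transitivity (n `^ b * (n^-1 * n^-1 `^ (b - 1)) *
    ((1 - n^-1 * t) ^+ k.+1 * t `^ (b - 1))); first by ring.
  rewrite mulr_powRB1 ?(ltW ni0)// -powRM ?(ltW ni0) ?(ltW n0)// mulfV ?gt_eqF//.
  by rewrite powR1 mul1r.
- move=> t /=; rewrite in_itv/= => /andP[t0 t1].
  rewrite lee_fin mulr_ge0 ?powR_ge0// exprn_ge0//.
  by rewrite subr_ge0 (le_trans _ d1)// mulrC ler_pdivrMr// ltW.
- apply/measurable_EFinP/measurable_funTS/measurable_funM.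
    by apply: measurable_funX; exact: measurable_affine.
  apply: (measurableT_comp (measurable_powR _)).
  by apply: measurable_funB => //; exact: measurable_affine.
- by rewrite mulr_ge0 ?powR_ge0// ltW.
Qed.

Lemma cvg_scaled_beta_integral b delta : 0 < b -> 0 < delta <= 1 ->
  ((k.+1%:R `^ b)%:E *
    \int[mu]_(x in `](1 - delta)%R, 1%R[) (x ^+ k.+1 * (1 - x) `^ (b - 1))%:E)%E
  @[k --> \oo] --> (Gamma b)%:E.
Proof.
move=> b0 d01; have /andP[d0 d1] := d01.
pose f k t := ((1 - k.+1%:R^-1 * t) ^+ k.+1 * t `^ (b - 1))%:E.
(* Extension by zero puts all the integrals on one domain, where the Gamma density dominates; each
   fixed t eventually lies below delta (k + 1). *)
pose F k := f k \_ `]0%R, (delta * k.+1%:R)%R[.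
have -> : (fun k => (k.+1%:R `^ b)%:E * \int[mu]_(x in `](1 - delta)%R, 1%R[)
      (x ^+ k.+1 * (1 - x) `^ (b - 1))%:E)%E =
    (fun k => \int[mu]_(t in `]0%R, +oo[) F k t)%E.
  apply/funext => k; rewrite scaled_beta_integral// -integral_mkcondr setIidr//.
  by move=> t /=; rewrite !in_itv/= andbT => /andP[].
have mf k (D : set R) : measurable_fun D (f k).
  apply/measurable_EFinP/measurable_funTS/measurable_funM; last exact: measurable_powR.
  by apply: measurable_funX; exact: measurable_affine.
have mF k (D : set R) : measurable D -> measurable_fun D (F k).
  move=> mD; apply/(measurable_restrict _ _ mD); first exact: measurable_itv.
  exact: mf.
rewrite -Gamma_EFin//.
have [] // := @dominated_convergence _ _ R mu `]0%R, +oo[%classic (measurable_itv _) F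
  (fun t => (t `^ (b - 1) * expR (- t))%:E) (fun t => (t `^ (b - 1) * expR (- t))%:E).
- by move=> k; apply: mF; exact: measurable_itv.
- by apply/measurable_EFinP; exact: measurable_gamma_density.
- apply: aeW => t /=; rewrite in_itv/= andbT => t0.
  have H : (1 - k.+1%:R^-1 * t) ^+ k.+1 * t `^ (b - 1) @[k --> \oo] -->
      t `^ (b - 1) * expR (- t).
    rewrite mulrC; apply: cvgMl; apply: cvg_onem_expr; exact: ltW.
  have H' : ((1 - k.+1%:R^-1 * t) ^+ k.+1 * t `^ (b - 1))%:E @[k --> \oo] -->
      (t `^ (b - 1) * expR (- t))%:E by apply: cvg_EFin; [exact: nearW|exact: H].
  apply: cvg_trans H'; apply: near_eq_cvg; near=> k.
  rewrite /F patchE mem_set//= in_itv/= t0/= -ltr_pdivrMl//.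
  near: k; have [N _ HN] := nbhs_infty_gtr (delta^-1 * t).
  by exists N => // k /= Nk; apply: HN; exact: leqW.
- exact: integrable_gamma_density.
- apply: aeW => t /= k; rewrite in_itv/= andbT => t0.
  rewrite /F patchE; case: ifPn => [|_]; last first.
    by rewrite abse0 lee_fin mulr_ge0 ?powR_ge0 ?expR_ge0.
  rewrite inE/= in_itv/= => /andP[_ tk].
  have tk1 : t <= k.+1%:R.
    by apply: (le_trans (ltW tk)); rewrite -[leRHS]mul1r ler_pM2r.
  rewrite lee_fin ger0_norm.
    by rewrite mulrC ler_wpM2l ?powR_ge0// onem_expr_le_expR.
  rewrite mulr_ge0 ?powR_ge0// exprn_ge0// subr_ge0.
  by rewrite mulrC ler_pdivrMr// mul1r.
Unshelve. all: by end_near. Qed.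

(** With s = - ln a / 2 and n = k + 1, n^b <= K e^(s n) while a^n = e^(-2 s n). This disposes of the
    mass away from 1. *)
Lemma cvg_powR_expr (b a : R) : 0 < b -> 0 < a < 1 ->
  k.+1%:R `^ b * a ^+ k.+1 @[k --> \oo] --> 0.
Proof.
move=> b0 /andP[a0 a1].
have s0 : 0 < - ln a / 2 by rewrite divr_gt0// oppr_gt0 ln_lt0// a0.
set s := - ln a / 2 in s0.
have [K K0 HK] := powR_le_expR (ltW b0) s0.
apply: (@squeeze_cvgr _ _ _ _ (fun=> 0) (fun k => K * expR (- s) ^+ k.+1)).
- apply: nearW => k; rewrite mulr_ge0 ?powR_ge0 ?exprn_ge0 ?(ltW a0)//=.
  apply: (@le_trans _ _ (K * expR (s * k.+1%:R) * a ^+ k.+1)).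
    by rewrite ler_wpM2r ?exprn_ge0 ?(ltW a0)// HK.
  rewrite -mulrA ler_pM2l// -(@lnK _ a) ?posrE// -!expRM_natl -expRD ler_expR /s.
  by rewrite le_eqVlt; apply/orP; left; apply/eqP; field.
- exact: cvg_cst.
- have -> : (fun k => K * expR (- s) ^+ k.+1) = geometric (K * expR (- s)) (expR (- s)).
    by apply/funext => k; rewrite /geometric/= exprS mulrA.
  by apply: cvg_geometric; rewrite gtr0_norm ?expR_gt0// expR_lt1 oppr_lt0.
Qed.

End beta.

(** * Moments of a law on [0, 1] *)

Section moments.
Variables (R : realType) (G : probability (measurableTypeR R) R).
Implicit Types (k j : nat).
Local Notation mu := (@lebesgue_measure R).

Section supported.
Hypothesis hG : supported01 G.

Let mX k (D : set R) : measurable_fun D (fun x : R => (x ^+ k)%:E).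
Proof. by apply/measurable_EFinP/measurable_funTS; exact: measurable_funX. Qed.

Let X0 k (x : R) : `[0, 1]%classic x -> (0 <= (x ^+ k)%:E)%E.
Proof. by rewrite /= in_itv/= => /andP[x0 _]; rewrite lee_fin exprn_ge0. Qed.

Let m01 : measurable (`[0, 1]%classic : set (measurableTypeR R)).
Proof. exact: measurable_itv. Qed.

Let moment_integral k :
  ('E_G[(fun a : R => (a ^+ k)%R)] = \int[G]_(x in `[0%R, 1%R]) (x ^+ k)%:E)%E.
Proof.
rewrite unlock [RHS]integral_mkcond; apply: ae_eq_integral => //.
- exact: mX.
- by apply/(measurable_restrictT _ m01); exact: mX.
exists (~` `[0, 1]%classic); split => //.
- exact: measurableC.
- by have := probability_setC G m01; rewrite hG subee.
- by move=> x /= + xI; apply => _; rewrite patchE mem_set.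
Qed.

Let integral_le1 k : (\int[G]_(x in `[0%R, 1%R]) (x ^+ k)%:E <= 1)%E.
Proof.
apply: (@le_trans _ _ (\int[G]_(x in `[0%R, 1%R]) 1)%E); last first.
  by rewrite integral_cst//= mul1e hG.
apply: ge0_le_integral => //.
- exact: X0.
- exact: mX.
- move=> x /=; rewrite in_itv/= => /andP[x0 x1].
  by rewrite lee_fin exprn_ile1.
Qed.

Lemma moment_EFin k : (moment G k)%:E = (\int[G]_(x in `[0%R, 1%R]) (x ^+ k)%:E)%E.
Proof.
rewrite /moment moment_integral fineK// ge0_fin_numE; last by apply: integral_ge0; exact: X0.
by rewrite (le_lt_trans (integral_le1 k))// ltry.
Qed.

Lemma moment_ge0 k : 0 <= moment G k.
Proof. by rewrite -lee_fin moment_EFin; apply: integral_ge0; exact: X0. Qed.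

Lemma moment_le k j : (k <= j)%N -> moment G j <= moment G k.
Proof.
move=> kj; rewrite -lee_fin !moment_EFin; apply: ge0_le_integral => //.
- exact: X0.
- exact: mX.
- exact: mX.
- move=> x /=; rewrite in_itv/= => /andP[x0 x1].
  by rewrite lee_fin ler_wiXn2l.
Qed.

Lemma mean_rate_moment : mean_rate G = moment G 1.
Proof. by rewrite /mean_rate /moment; under [in RHS]eq_fun do rewrite expr1. Qed.

(** Integrate Bernoulli's inequality 1 - k (1 - x) <= x^k. Both sides are written as sums so that
    the extended-real integrals need no subtraction. *)
Lemma moment_bernoulli k : 1 + k%:R * moment G 1 <= moment G k + k%:R.
Proof.
have cstE (c : R) : c%:E = (\int[G]_(x in `[0%R, 1%R]) c%:E)%E.
  by rewrite integral_cst//= hG mule1.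
have m1X : measurable_fun (`[0%R, 1%R] : set R) (fun x : R => (k%:R%:E * (x ^+ 1)%:E)%E).
  by apply: measurable_funeM; exact: mX.
have X10 (x : R) : `[0, 1]%classic x -> (0 <= k%:R%:E * (x ^+ 1)%:E)%E.
  by move=> xI; rewrite mule_ge0// X0.
rewrite -lee_fin !EFinD EFinM !moment_EFin -ge0_integralZl_EFin//;
  do ?[exact: X0|exact: mX].
rewrite [X in (X + _ <= _)%E]cstE [X in (_ <= _ + X)%E]cstE -!ge0_integralD//;
  do ?[exact: X0|exact: mX|exact: X10|by move=> x _; rewrite lee_fin].
apply: ge0_le_integral => //.
- by move=> x xI; rewrite adde_ge0// X10.
- exact: emeasurable_funD.
- by apply: emeasurable_funD => //; exact: mX.
- move=> x /=; rewrite in_itv/= => /andP[x0 x1].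
  rewrite -EFinM -!EFinD lee_fin expr1.
  have := @bernoulli_onem R (1 - x) k; rewrite subr_ge0 x1 gerBl x0 => /(_ isT).
  rewrite (_ : 1 - (1 - x) = x); last by ring.
  by rewrite mulrBr mulr1; lra.
Qed.

End supported.

(** Brings the interval where [g] is a density and the one where the asymptotic equivalence is
    accurate to within [e] down to a common one. *)
Lemma near_left_density (b cG e : R) (g : R -> R) :
  0 < cG -> 0 < e -> left_density_at1 G g ->
  g ~_(1^'-) (fun a : R => cG * (1 - a) `^ (b - 1)) ->
  exists delta : R, [/\ 0 < delta < 1,
    measurable_fun (`]1 - delta, 1[ : set R) g,
    (forall x, 1 - delta < x < 1 ->
      (1 - e) * (cG * (1 - x) `^ (b - 1)) <= g x
        <= (1 + e) * (cG * (1 - x) `^ (b - 1))) &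
    forall A : set R, measurable A -> A `<=` `]1 - delta, 1[ ->
      G A = (\int[mu]_(x in A) (g x)%:E)%E].
Proof.
move=> cG0 e0 [a [a1 mg g0 gE]] /eqaddoP/(_ e e0) gh.
have [d d0 Hd] := gh.
(* The three bounds keep the interval inside ]a, 1[, inside the radius [d] of the equivalence, and
   away from 0. *)
exists (Num.min (1 - a) (Num.min (d / 2) 2^-1)).
set delta := Num.min _ _.
have delta0 : 0 < delta by rewrite /delta !lt_min subr_gt0 a1 divr_gt0//= invr_gt0 ltr0n.
have da : delta <= 1 - a by rewrite /delta ge_min lexx.
have dd : delta <= d / 2 by rewrite /delta !ge_min lexx orbT.
have d2 : delta <= 2^-1 by rewrite /delta !ge_min lexx !orbT.
have sub : `]1 - delta, 1[%classic `<=` (`]a, 1[%classic : set R).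
  by move=> x /=; rewrite !in_itv/= => /andP[x1 ->]; rewrite andbT; lra.
split.
- by rewrite delta0/=; lra.
- by apply: measurable_funS mg => //; exact: measurable_itv.
- move=> x /andP[xd x1].
  have h0 : 0 <= cG * (1 - x) `^ (b - 1) by rewrite mulr_ge0 ?powR_ge0// ltW.
  have := Hd x; rewrite /= => /(_ _ x1); rewrite gtr0_norm ?subr_gt0//.
  have -> : 1 - x < d by lra.
  move=> /(_ isT); rewrite (ger0_norm h0).
  rewrite -[(g - _) x]/(g x - _) ler_norml => /andP[h1 h2].
  by apply/andP; split; lra.
- by move=> A mA AD; apply: gE => //; exact: subset_trans sub.
Qed.

End moments.

(** * Asymptotics of the moments *)

Section moment_asymptotics.
Variables (R : realType) (G : probability (measurableTypeR R) R) (b cG : R) (g : R -> R).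
Hypotheses (hG : supported01 G) (hatom : G [set 1] = 0%E).
Hypotheses (b0 : 0 < b) (cG0 : 0 < cG) (hdens : left_density_at1 G g).
Hypothesis hg : g ~_(1^'-) (fun a : R => cG * (1 - a) `^ (b - 1)).
Local Notation mu := (@lebesgue_measure R).

Let mX k (D : set R) : measurable_fun D (fun x : R => (x ^+ k)%:E).
Proof. by apply/measurable_EFinP/measurable_funTS; exact: measurable_funX. Qed.

(** Cut [0, 1] into [0, 1 - delta], ]1 - delta, 1[ and the null set {1}. On the first piece x^k <=
    (1 - delta)^k, and its mass is at most 1. *)
Lemma moment_split (delta : R) (k : nat) : 0 < delta < 1 ->
  (\int[G]_(x in `](1 - delta)%R, 1%R[) (x ^+ k)%:E <= (moment G k)%:E <=
   ((1 - delta) ^+ k)%:E + \int[G]_(x in `](1 - delta)%R, 1%R[) (x ^+ k)%:E)%E.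
Proof.
move=> /andP[d0 d1].
have X0 (x : R) : 0 <= x -> (0 <= (x ^+ k)%:E)%E by move=> x0; rewrite lee_fin exprn_ge0.
have X0d (D : set R) : D `<=` `[0, 1] -> forall x, D x -> (0 <= (x ^+ k)%:E)%E.
  by move=> D01 x /D01/=; rewrite in_itv/= => /andP[x0 _]; exact: X0.
have s1 : `[0, 1 - delta]%classic `<=` (`[0, 1]%classic : set R).
  by move=> x /=; rewrite !in_itv/= => /andP[-> h]/=; lra.
have s2 : `]1 - delta, 1[%classic `<=` (`[0, 1]%classic : set R).
  by move=> x /=; rewrite !in_itv/= => /andP[h1 h2]; apply/andP; split; lra.
have s3 : [set 1] `<=` (`[0, 1]%classic : set R).
  by move=> x /= ->; rewrite in_itv/= ler01 lexx.
have E01 : (`[0, 1]%classic : set R) =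
    `[0, 1 - delta]%classic `|` (`]1 - delta, 1[%classic `|` [set 1]).
  rewrite -set_itv1 -itv_bndbnd_setU ?bnd_simp//; last lra.
  by rewrite -itv_bndbnd_setU ?bnd_simp//; lra.
rewrite moment_EFin// E01.
rewrite ge0_integral_setU//; last 4 first.
- exact: measurableU.
- exact: mX.
- by rewrite -E01; exact: X0d.
- apply/disj_setPS => x [] /=; rewrite !in_itv/= => /andP[_ h1].
  by move=> [/andP[h2 _]|h2]; lra.
rewrite ge0_integral_setU//; last 3 first.
- exact: mX.
- by apply: X0d => x [/s2|/s3].
- by apply/disj_setPS => x [] /=; rewrite !in_itv/= => /andP[_ h1] h2; lra.
rewrite (@null_set_integral _ _ _ G [set 1])//; last exact: mX.
rewrite adde0 leeDr ?leeD2r//=; last first.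
  by apply: integral_ge0; exact: X0d.
apply: (@le_trans _ _ (\int[G]_(x in `[0%R, (1 - delta)%R]) ((1 - delta) ^+ k)%:E)%E).
  apply: ge0_le_integral => //.
  - exact: X0d.
  - exact: mX.
  - move=> x /=; rewrite in_itv/= => /andP[x0 xd].
    by rewrite lee_fin lerXn2r// nnegrE; lra.
rewrite integral_cst//= -[leRHS]mule1 lee_wpmul2l ?lee_fin ?exprn_ge0 ?probability_le1//.
lra.
Qed.

(** [delta] is chosen before [k], so that one interval serves all moments and k can tend to infinity
    afterwards. *)
Lemma moment_sandwich (e : R) : 0 < e < 1 -> exists delta : R,
  0 < delta < 1 /\ forall k, exists2 N : R,
    (N%:E = \int[mu]_(x in `](1 - delta)%R, 1%R[)
      (x ^+ k * (1 - x) `^ (b - 1))%:E)%E &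
    (1 - e) * (cG * N) <= moment G k <= (1 - delta) ^+ k + (1 + e) * (cG * N).
Proof.
move=> /andP[e0 e1].
have [delta [d01 mg gh gE]] := near_left_density cG0 e0 hdens hg.
exists delta; split => // k; have /andP[d0 d1] := d01.
set D := `](1 - delta)%R, 1%R[%classic : set R.
have mD : measurable D by exact: measurable_itv.
have Dx x : D x -> 1 - delta < x < 1 by rewrite /D/= in_itv.
have D0 x : D x -> 0 <= x by move=> /Dx/andP[h _]; lra.
have B0 x : D x -> (0 <= (x ^+ k * (1 - x) `^ (b - 1))%:E)%E.
  by move=> xD; rewrite lee_fin mulr_ge0 ?powR_ge0// exprn_ge0// D0.
have mB := @measurable_beta_density R b k D.
set Ne := (\int[mu]_(x in D) _)%E.
have Ne0 : (0 <= Ne)%E by exact: integral_ge0.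
have IE : (\int[G]_(x in D) (x ^+ k)%:E = \int[mu]_(x in D) (x ^+ k * g x)%:E)%E.
  (* the density lemma wants an integrand that is nonnegative everywhere *)
  transitivity (\int[G]_(x in D) (`|x| ^+ k)%:E)%E.
    by apply: eq_integral => x /set_mem/D0 x0; rewrite ger0_norm.
  rewrite (@ge0_integral_density _ _ R G mu D g)//.
  - apply: eq_integral => x /set_mem/D0 x0; rewrite -EFinM ger0_norm//.
  - by rewrite (le_lt_trans (probability_le1 G mD))// ltry.
  - apply/measurable_EFinP/measurable_funX; exact: measurable_funTS (@normr_measurable _ _).
have mXg : measurable_fun D (fun x => (x ^+ k * g x)%:E).
  by apply/measurable_EFinP/measurable_funM => //; exact: measurable_funX.
have h0 x : 0 <= cG * (1 - x) `^ (b - 1) by rewrite mulr_ge0 ?powR_ge0// ltW.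
have lo : (((1 - e) * cG)%:E * Ne <= \int[G]_(x in D) (x ^+ k)%:E)%E.
  have c0 : 0 <= (1 - e) * cG by rewrite mulr_ge0 ?subr_ge0// ltW.
  rewrite IE -ge0_integralZl_EFin//.
  apply: ge0_le_integral => //.
  - by move=> x /B0 h; rewrite mule_ge0.
  - exact: measurable_funeM.
  - move=> x xD; have /andP[l _] := gh _ (Dx _ xD).
    rewrite -EFinM lee_fin [leLHS](_ : _ = x ^+ k * ((1 - e) * (cG * (1 - x) `^ (b - 1)))).
      by rewrite ler_wpM2l// exprn_ge0// D0.
    by ring.
have up : (\int[G]_(x in D) (x ^+ k)%:E <= ((1 + e) * cG)%:E * Ne)%E.
  have c0 : 0 <= (1 + e) * cG by rewrite mulr_ge0 ?addr_ge0// ltW.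
  rewrite IE -ge0_integralZl_EFin//.
  apply: ge0_le_integral => //.
  - move=> x xD; rewrite lee_fin mulr_ge0 ?exprn_ge0 ?(D0 _ xD)//.
    have /andP[l _] := gh _ (Dx _ xD); apply: le_trans l.
    by rewrite mulr_ge0// subr_ge0 ltW.
  - exact: measurable_funeM.
  - move=> x xD; have /andP[_ l] := gh _ (Dx _ xD).
    rewrite -EFinM lee_fin [leRHS](_ : _ = x ^+ k * ((1 + e) * (cG * (1 - x) `^ (b - 1)))).
      by rewrite ler_wpM2l// exprn_ge0// D0.
    by ring.
have /andP[l u] := moment_split k d01.
have ec : 0 < (1 - e) * cG by rewrite mulr_gt0// subr_gt0.
(* Finiteness comes from the lower bound itself: an infinite beta integral would force the finite
   moment to be infinite. *)
have NeE : (fine Ne)%:E = Ne.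
  rewrite fineK// ge0_fin_numE// ltey; apply/eqP => Noo.
  by have := le_trans lo l; rewrite Noo gt0_muley ?lte_fin// leye_eq.
exists (fine Ne) => //; rewrite -NeE in lo up.
rewrite !mulrA; apply/andP; split; rewrite -lee_fin.
  by rewrite EFinM; exact: le_trans lo l.
by apply: (le_trans u); rewrite EFinD EFinM leeD2l.
Qed.

Lemma cvg_moment : k%:R `^ b * moment G k @[k --> \oo] --> cG * Gamma b.
Proof.
rewrite -cvg_shiftS/=.
set L := cG * Gamma b.
have L0 : 0 < L by rewrite mulr_gt0// Gamma_gt0.
apply/cvgrPdist_le => eps eps0.
have L4 : 0 < 4 * L by exact: mulr_gt0.
(* Error budget: eps/4 each for e L, the beta integral and the tail (1 - delta)^k; the cross term e
   eps / 4 is at most eps/8 since e <= 1/2. *)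
pose e := Num.min 2^-1 (eps / (4 * L)).
have e0 : 0 < e by rewrite /e lt_min invr_gt0 ltr0n/= divr_gt0.
have e2 : e <= 2^-1 by rewrite /e ge_min lexx.
have eL : e * L <= eps / 4.
  have : e <= eps / (4 * L) by rewrite /e ge_min lexx orbT.
  rewrite ler_pdivlMr// => h; lra.
have [|delta [d01 sand]] := @moment_sandwich e; first by rewrite e0/=; lra.
have /andP[d0 d1] := d01.
have dd : 0 < delta <= 1 by rewrite d0 ltW.
have dd' : 0 < 1 - delta < 1 by apply/andP; split; lra.
have /fine_cvgP[_ Bcvg] := cvg_scaled_beta_integral b0 dd.
have v : cG * (fine ((k.+1%:R `^ b)%:E * \int[mu]_(x in `](1 - delta)%R, 1%R[)
    (x ^+ k.+1 * (1 - x) `^ (b - 1))%:E)%E) @[k --> \oo] --> L.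
  by apply: cvgMr.
have w := cvg_powR_expr b0 dd'.
have eps4 : 0 < eps / 4 by rewrite divr_gt0.
have /cvgrPdist_le/(_ _ eps4) v' := v.
have /cvgrPdist_le/(_ _ eps4) w' := w.
near=> k.
have hv : `|L - cG * fine ((k.+1%:R `^ b)%:E * \int[mu]_(x in `](1 - delta)%R, 1%R[)
    (x ^+ k.+1 * (1 - x) `^ (b - 1))%:E)%E| <= eps / 4 by near: k; exact: v'.
have hw : `|0 - k.+1%:R `^ b * (1 - delta) ^+ k.+1| <= eps / 4 by near: k; exact: w'.
move: hv hw; have [N NE] := sand k.+1; rewrite -NE -EFinM/=.
set K := k.+1%:R `^ b; set m := moment G k.+1; set W := (1 - delta) ^+ k.+1.
have K0 : 0 <= K by exact: powR_ge0.
move=> /andP[lo up] hv hw.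
move: hw; rewrite sub0r normrN ler_norml => /andP[_ hw].
move: hv; rewrite ler_distlC => /andP[hv1 hv2].
have lo' : (1 - e) * (cG * (K * N)) <= K * m.
  by rewrite [leLHS](_ : _ = K * ((1 - e) * (cG * N))) ?ler_wpM2l//; ring.
have up' : K * m <= K * W + (1 + e) * (cG * (K * N)).
  rewrite [leRHS](_ : _ = K * (W + (1 + e) * (cG * N))) ?ler_wpM2l//; ring.
have lo2 : (1 - e) * (L - eps / 4) <= (1 - e) * (cG * (K * N)) by rewrite ler_wpM2l//; lra.
have up2 : (1 + e) * (cG * (K * N)) <= (1 + e) * (L + eps / 4) by rewrite ler_wpM2l//; lra.
have ee : e * eps <= 2^-1 * eps by rewrite ler_wpM2r// ltW.
have ee0 : 0 < e * eps by rewrite mulr_gt0.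
rewrite ler_distlC; apply/andP; split; lra.
Unshelve. all: by end_near. Qed.

End moment_asymptotics.

(** * Posterior and optimal gate counts *)

Section posterior.
Variables (R : realType) (P : probability (measurableTypeR R) R) (p : R).
Hypotheses (p01 : 0 < p < 1) (mom0 : forall k, 0 <= moment P k).
Implicit Types (k j : nat) (U c : R).

Let p0 : 0 < p. Proof. by case/andP: p01. Qed.
Let q0 : 0 < 1 - p. Proof. by rewrite subr_gt0; case/andP: p01. Qed.
Let den0 k : 0 < p + (1 - p) * moment P k.
Proof. by rewrite ltr_wpDr// mulr_ge0// ltW. Qed.

Lemma onem_posterior k :
  1 - posterior P p k = (1 - p) * moment P k / (p + (1 - p) * moment P k).
Proof. by rewrite /posterior; field; rewrite gt_eqF. Qed.

Lemma posterior_ge0 k : 0 <= posterior P p k.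
Proof. by rewrite divr_ge0// ltW. Qed.

Lemma posterior_le1 k : posterior P p k <= 1.
Proof. by rewrite ler_pdivrMr// mul1r lerDl mulr_ge0// ltW. Qed.

(** Once j >= U/c, the objective is at most U - c j <= 0, while it is nonnegative at 0 gates. A
    maximizer over the finite range up to N >= U/c is therefore global. *)
Lemma optimal_gates_ex U c : 0 < U -> 0 < c -> exists k, optimal_gates P p U c k.
Proof.
move=> U0 c0; have [N /andP[N1 _]] := natr_ceil (ltW (divr_gt0 U0 c0)).
have /= [i _ imax] := @arg_maxP _ _ _ (ord0 : 'I_N.+1) xpredT
  (fun i : 'I_N.+1 => objective P p U c i) isT.
exists i => j; have [jN|Nj] := ltnP j N.+1; first exact: (imax (Ordinal jN)).
apply: le_trans (imax ord0 isT); rewrite /objective mulr0 subr0.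
apply: (@le_trans _ _ 0); last by rewrite mulr_ge0 ?posterior_ge0// ltW.
have Nj' : N%:R <= j%:R :> R by rewrite ler_nat ltnW.
have : U / c <= j%:R by exact: le_trans Nj'.
rewrite ler_pdivrMr// => Uj; rewrite subr_le0 mulrC.
apply: (@le_trans _ _ U); last by rewrite mulrC.
by rewrite -[leRHS]mul1r ler_pM2r// posterior_le1.
Qed.

Lemma optimal_gates_cost U c k j : 0 < c -> optimal_gates P p U c k ->
  U / c * (1 - posterior P p k) + k%:R <= U / c * (1 - posterior P p j) + j%:R.
Proof.
move=> c0 /(_ j); rewrite /objective => opt; rewrite -(ler_pM2r c0).
have E (x : R) (n : nat) :
    (U / c * (1 - x) + n%:R) * c = U - (U * x - c * n%:R).
  by field; rewrite gt_eqF.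
by rewrite !E lerD2l lerN2.
Qed.

End posterior.

(** * Posterior error and optimal gate count for a power-type density at 1 *)

Section power_tail.
Variables (R : realType) (G : probability (measurableTypeR R) R) (p b cG : R) (g : R -> R).
Hypotheses (p01 : 0 < p < 1) (hG : supported01 G) (hatom : G [set 1] = 0%E).
Hypotheses (b0 : 0 < b) (cG0 : 0 < cG) (hdens : left_density_at1 G g).
Hypothesis hg : g ~_(1^'-) (fun a : R => cG * (1 - a) `^ (b - 1)).

Let mcvg := cvg_moment hG hatom b0 cG0 hdens hg.

Let p0 : 0 < p. Proof. by case/andP: p01. Qed.
Let q0 : 0 < 1 - p. Proof. by rewrite subr_gt0; case/andP: p01. Qed.

Lemma cvg_natr_powRN : (k%:R : R) `^ (- b) @[k --> \oo] --> 0.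
Proof.
under eq_cvg do rewrite powRN.
apply/gtr0_cvgV0; last by apply: cvgy_powR => //; exact: cvgr_idn.
near=> k; rewrite powR_gt0// ltr0n; near: k; exact: nbhs_infty_gt.
Unshelve. all: by end_near. Qed.

Lemma cvg_moment0 : moment G k @[k --> \oo] --> 0.
Proof.
have H : k%:R `^ (- b) * (k%:R `^ b * moment G k) @[k --> \oo] --> 0.
  by rewrite -[X in _ --> X](mul0r (cG * Gamma b)); apply: cvgM => //; exact: cvg_natr_powRN.
apply: cvg_trans H; apply: near_eq_cvg; near=> k.
rewrite mulrA powRN mulVf ?mul1r// gt_eqF// powR_gt0// ltr0n.
by near: k; exact: nbhs_infty_gt.
Unshelve. all: by end_near. Qed.

(** The positive limit of k^b m_k makes some moment of index at least [k] positive, and moments are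
    nonincreasing. *)
Lemma moment_gt0 k : 0 < moment G k.
Proof.
have L0 : 0 < cG * Gamma b by rewrite mulr_gt0// Gamma_gt0.
have [N _ HN] : \forall j \near \oo, 0 < j%:R `^ b * moment G j.
  exact: cvgr_gt mcvg _ L0.
have := HN (maxn N k) (leq_maxl _ _); rewrite /= => h.
have : 0 < moment G (maxn N k).
  by rewrite lt_neqAle moment_ge0// andbT; apply: contraTneq h => <-; rewrite mulr0 ltxx.
by move=> h'; apply: lt_le_trans h' _; apply: moment_le => //; exact: leq_maxr.
Qed.

(** Makes the point mass at the mean rate of [G] an admissible instance of the independent case. *)
Lemma mean_rate_bounds : 0 < mean_rate G < 1.
Proof.
rewrite mean_rate_moment moment_gt0/=.
have [N _ HN] : \forall j \near \oo, moment G j < 1 by exact: cvgr_lt cvg_moment0 _ ltr01.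
have m1 : moment G N < 1 by apply: HN => /=.
have := moment_bernoulli hG N; rewrite ltNge => h; apply/negP => h1.
have : N%:R <= N%:R * moment G 1 by rewrite ler_peMr.
by move: m1 h; lra.
Qed.

(** In k^b (1 - r_k) = (1 - p) k^b m_k / (p + (1 - p) m_k), the denominator tends to [p] because m_k
    tends to 0. *)
Lemma cvg_onem_posterior :
  k%:R `^ b * (1 - posterior G p k) @[k --> \oo] --> kappa p cG b.
Proof.
under eq_cvg do rewrite (onem_posterior p01 (moment_ge0 hG)).
have -> : kappa p cG b = (1 - p) * (cG * Gamma b) / (p + (1 - p) * 0).
  by rewrite /kappa mulr0 addr0; field; rewrite gt_eqF.
have -> : (fun k => k%:R `^ b * ((1 - p) * moment G k / (p + (1 - p) * moment G k))) =
    (fun k => (1 - p) * (k%:R `^ b * moment G k) / (p + (1 - p) * moment G k)).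
  by apply/funext => k; rewrite !mulrA (mulrC (k%:R `^ b)).
apply: cvgM; first exact: cvgMr.
apply: cvgV; first by rewrite mulr0 addr0 gt_eqF.
by apply: cvgD; [exact: cvg_cst|apply: cvgMr; exact: cvg_moment0].
Qed.

Lemma kappa_gt0 : 0 < kappa p cG b.
Proof. by rewrite !mulr_gt0 ?invr_gt0// Gamma_gt0. Qed.

Lemma equiv_onem_posterior :
  (fun k => 1 - posterior G p k) ~_\oo (fun k => kappa p cG b * k%:R `^ (- b)).
Proof.
apply: near_equiv => e e0; have k0 := kappa_gt0.
have /cvgrPdist_le/(_ _ (mulr_gt0 e0 k0)) H := cvg_onem_posterior.
near=> k.
have kb : 0 < (k%:R : R) `^ b.
  by rewrite powR_gt0// ltr0n; near: k; exact: nbhs_infty_gt.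
have : `|kappa p cG b - k%:R `^ b * (1 - posterior G p k)| <= e * kappa p cG b.
  by near: k; exact: H.
have kbi : 0 < ((k%:R : R) `^ b)^-1 by rewrite invr_gt0.
have -> : kappa p cG b - k%:R `^ b * (1 - posterior G p k) =
    - ((1 - posterior G p k - kappa p cG b * (k%:R `^ b)^-1) * k%:R `^ b).
  by field; rewrite gt_eqF.
rewrite normrN normrM (gtr0_norm kb) => h.
rewrite powRN normrM (gtr0_norm k0) (gtr0_norm kbi) (mulrA e (kappa p cG b)).
by rewrite ler_pdivlMr.
Unshelve. all: by end_near. Qed.

Lemma equiv_optimal_gates (U c : nat -> R) (kstar : nat -> nat) :
  (forall n, 0 < U n) -> (forall n, 0 < c n) ->
  U n / c n @[n --> \oo] --> +oo ->
  (forall n, optimal_gates G p (U n) (c n) (kstar n)) ->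
  (fun n => (kstar n)%:R)
    ~_\oo (fun n => (U n * kappa p cG b * b / c n) `^ (b + 1)^-1).
Proof.
move=> U0 c0 Uc opt.
have -> : (fun n => (U n * kappa p cG b * b / c n) `^ (b + 1)^-1) =
    (fun n => (U n / c n * kappa p cG b * b) `^ (b + 1)^-1).
  by apply/funext => n; congr (_ `^ _); rewrite -!mulrA; congr (_ * _); ring.
apply: (@power_law_minimizer R (fun k => 1 - posterior G p k)) => //.
- exact: kappa_gt0.
- move=> k; rewrite (onem_posterior p01 (moment_ge0 hG)).
  by rewrite divr_gt0 ?addr_gt0 ?mulr_gt0 ?moment_gt0.
- move=> j k jk; rewrite lerD2l lerN2 /posterior ler_pM2l//.
  rewrite lef_pV2 ?posrE ?addr_gt0 ?mulr_gt0 ?moment_gt0//.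
  by rewrite lerD2l ler_pM2l// moment_le.
- exact: cvg_onem_posterior.
- by move=> n; rewrite divr_gt0.
- by move=> n j; exact: optimal_gates_cost.
Qed.

End power_tail.

(** * Independent gates: a deterministic false-accept rate *)

Section point_mass.
Variables (R : realType) (p a : R).
Hypotheses (p01 : 0 < p < 1) (a01 : 0 < a < 1).

Let p0 : 0 < p. Proof. by case/andP: p01. Qed.
Let q0 : 0 < 1 - p. Proof. by rewrite subr_gt0; case/andP: p01. Qed.
Let a0 : 0 < a. Proof. by case/andP: a01. Qed.

Lemma moment_point_mass k : moment (point_mass a) k = a ^+ k.
Proof.
rewrite /moment unlock integral_dirac//; first by rewrite diracT mul1e.
by apply/measurable_EFinP; exact: measurable_funX.
Qed.

Lemma moment_point_mass_ge0 k : 0 <= moment (point_mass a) k.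
Proof. by rewrite moment_point_mass exprn_ge0// ltW. Qed.

(** Here 1 - r_k = (1 - p) a^k / (p + (1 - p) a^k), with denominator between [p] and 1; this yields
    the constants 1 - p and (1 - p) / p for [geometric_law_minimizer]. *)
Lemma equiv_optimal_gates_point_mass (U c : nat -> R) (kstar : nat -> nat) :
  (forall n, 0 < U n) -> (forall n, 0 < c n) ->
  U n / c n @[n --> \oo] --> +oo ->
  (forall n, optimal_gates (point_mass a) p (U n) (c n) (kstar n)) ->
  (fun n => (kstar n)%:R) ~_\oo (fun n => ln (U n / c n) / ln a^-1).
Proof.
move=> U0 c0 Uc opt.
apply: (@geometric_law_minimizer R (fun k => 1 - posterior (point_mass a) p k)
  (fun n => U n / c n) kstar a (1 - p) ((1 - p) / p)) => //.
- move=> k; rewrite (onem_posterior p01 moment_point_mass_ge0) moment_point_mass.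
  have ak : 0 < a ^+ k by rewrite exprn_gt0.
  have ak1 : a ^+ k <= 1 by rewrite exprn_ile1// ltW//; case/andP: a01.
  have d0 : 0 < p + (1 - p) * a ^+ k by rewrite addr_gt0// mulr_gt0.
  apply/andP; split.
    rewrite ler_pdivlMr// -[leRHS]mulr1 ler_pM2l ?mulr_gt0//.
    by rewrite -lerBrDl -[leRHS]mulr1 ler_pM2l.
  rewrite [leLHS]mulrAC ler_pM2r// ler_pM2l//.
  by rewrite lef_pV2 ?posrE// lerDl mulr_ge0// ltW.
- by move=> n; rewrite divr_gt0.
- by move=> n j; apply: optimal_gates_cost.
Qed.

End point_mass.

Theorem corollary3p8 (R : realType)
  (G : probability (measurableTypeR R) R) (p0 b cG : R) (g : R -> R)
  (hp0 : 0 < p0 < 1) (hG : supported01 G)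
  (hatom : G [set 1] = 0%E)
  (hb : 0 < b) (hcG : 0 < cG)
  (hdens : left_density_at1 G g)
  (hg : g ~_(1^'-) (fun a : R => cG * (1 - a) `^ (b - 1))) :
  [/\
    (fun k : nat => 1 - posterior G p0 k)
      ~_\oo (fun k : nat => kappa p0 cG b * k%:R `^ (- b)),

    (forall U c : R, 0 < U -> 0 < c -> exists k, optimal_gates G p0 U c k) /\
    (forall (U c : nat -> R) (kstar : nat -> nat),
      (forall n, 0 < U n) -> (forall n, 0 < c n) ->
      U n / c n @[n --> \oo] --> +oo ->
      (forall n, optimal_gates G p0 (U n) (c n) (kstar n)) ->
      (fun n => (kstar n)%:R)
        ~_\oo (fun n => (U n * kappa p0 cG b * b / c n) `^ (b + 1)^-1)),

    0 < mean_rate G < 1 &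
    forall abar : R, 0 < abar < 1 ->
      (forall U c : R, 0 < U -> 0 < c ->
        exists k, optimal_gates (point_mass abar) p0 U c k) /\
      (forall (U c : nat -> R) (kstar : nat -> nat),
        (forall n, 0 < U n) -> (forall n, 0 < c n) ->
        U n / c n @[n --> \oo] --> +oo ->
        (forall n, optimal_gates (point_mass abar) p0 (U n) (c n) (kstar n)) ->
        (fun n => (kstar n)%:R)
          ~_\oo (fun n => ln (U n / c n) / ln abar^-1))].
Proof.
have mom0 := moment_ge0 hG.
split.
- exact: equiv_onem_posterior hdens hg.
- split; first by move=> U c; exact: optimal_gates_ex.
  exact: equiv_optimal_gates hdens hg.
- exact: mean_rate_bounds hdens hg.
- move=> abar abar01; split; last exact: equiv_optimal_gates_point_mass.
  by move=> U c; apply: optimal_gates_ex => // k; exact: moment_point_mass_ge0.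
Qed.
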